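(* Let $c\in[1,3)$, $T\in[0,+\infty)$, $\sigma\in\mathbb{R}_+$, $\underline{u}\in H_+$ and $w\in C([0,T],\mathbb{R})$ with $w(0)=0$. There exists a function $f:\mathbb{R}_+\to\mathbb{R}_+$ with $\lim_{\delta\to0}f(\delta)=0$ such that, for all $\delta>0$, all $\underline{\tilde u}\in H_+$ and all $\tilde w\in C([0,T],\mathbb{R})$ with $\tilde w(0)=0$, if $$\|\underline{u}-\underline{\tilde u}\|<\delta\quad\text{and}\quad \|w-\tilde w\|_\infty<\delta,$$ then $$\sup_{t\in[0,T]}\|u(t)-\tilde u(t)\|_{-\frac12}<f(\delta),$$ where $u$ (resp. $\tilde u$) is a solution of the dyadic system on $[0,T]$ with initial condition $\underline{u}$ (resp. $\underline{\tilde u}$) and noise $w$ (resp. $\tilde w$). Moreover, if $w=\tilde w$ and $\underline{u}\ne\underline{\tilde u}$, then $$\|u(t)-\tilde u(t)\|_{-\frac12}<\|u(0)-\tilde u(0)\|_{-\frac12}\qquad\text{for every } t\in(0,T].$$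
   Context: Sequences $u=(u_j)_{j\ge0}$ are real and indexed by $j\ge 0$; $\|\cdot\|$ is the $\ell^2$-norm and $\|\cdot\|_\infty$ the sup-norm on $[0,T]$. $\mathbb{R}_+=[0,\infty)$. $H_+=\{u\in\ell^2: u_j\ge 0 \text{ for all } j\ge1\}$ (no sign condition on $u_0$). For $\alpha\in\mathbb{R}$, $\|u\|_\alpha^2=\sum_{j=0}^\infty 2^{2\alpha j}u_j^2$; in particular $\|u\|_{-1/2}^2=\sum_{j\ge0}2^{-j}u_j^2$. Dyadic system (with parameters $\sigma,c$, initial condition $\underline{u}$ and noise $w$): $$\left\{\begin{array}{ll} u_0(t)=u_0(0)-\int_0^t u_1(s)u_0(s)\,ds+\sigma w(t) & \\ \frac{d}{dt}u_j=-2^{cj}u_ju_{j+1}+2^{c(j-1)}u_{j-1}^2 & \text{for } j\ge1\\ u(0)=\underline{u} & \end{array}\right.\qquad t\in[0,T].$$ A solution on $[0,T]$ with initial condition $\underline{u}\in H_+$ and noise $w\in C([0,T],\mathbb{R})$, $w(0)=0$, is a $u=(u_j)_{j\ge0}$ satisfying this system with $u_j\in C([0,T],\mathbb{R})$ for all $j$ and $u(t)\in H_+$ for all $t\in[0,T]$. *)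

(* Defs.v *)
From Stdlib Require Import Reals.
From Coquelicot Require Import Coquelicot.
Open Scope R_scope.

Definition in_l2 (u : nat -> R) : Prop := ex_series (fun j => (u j) ^ 2).

Definition in_Hplus (u : nat -> R) : Prop :=
  in_l2 u /\ forall j : nat, (1 <= j)%nat -> 0 <= u j.

(* [Series] is total and meaningless on divergent series; [norm_l2] and
   [norm_alpha (-1/2)] are only applied to differences of elements of H_+,
   which are square summable. *)
Definition norm_l2 (u : nat -> R) : R := sqrt (Series (fun j => (u j) ^ 2)).

Definition norm_alpha (alpha : R) (u : nat -> R) : R :=
  sqrt (Series (fun j => Rpower 2 (2 * alpha * INR j) * (u j) ^ 2)).

Definition seq_sub (u v : nat -> R) : nat -> R := fun j => u j - v j.

(* Functions on [0,T] are represented by total functions on R of which only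
   the values on [0,T] matter. *)
Definition segment (T t : R) : Prop := 0 <= t <= T.

(* A supremum in the extended reals, so that the bound [sup < M] with M real
   includes finiteness. *)
Definition sup_on (T : R) (g : R -> R) : Rbar :=
  Lub_Rbar (fun y => exists t, segment T t /\ y = g t).

(* Derivative relative to D: for D = [0,T] it is two-sided in the interior,
   one-sided at the end points, and imposes nothing when T = 0. *)
Definition is_derive_within (D : R -> Prop) (g : R -> R) (x l : R) : Prop :=
  filterlim (fun s => (g s - g x) / (s - x)) (within D (locally' x)) (locally l).

(* [u t j] is the j-th component of u(t). The integrand below is continuous on
   [0,T], so [RInt] is a genuine Riemann integral. *)
Record is_solution (c sigma T : R) (u_init : nat -> R) (w : R -> R)
    (u : R -> nat -> R) : Prop := {
  sol_continuous : forall j : nat, continuous_on (segment T) (fun t => u t j);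
  sol_Hplus : forall t, segment T t -> in_Hplus (u t);
  sol_init : forall j : nat, u 0 j = u_init j;
  sol_zero : forall t, segment T t ->
    u t 0%nat = u 0 0%nat - RInt (fun s => u s 1%nat * u s 0%nat) 0 t
                + sigma * w t;
  sol_succ : forall j : nat, (1 <= j)%nat -> forall t, segment T t ->
    is_derive_within (segment T) (fun s => u s j) t
      (- Rpower 2 (c * INR j) * u t j * u t (j + 1)%nat
       + Rpower 2 (c * (INR j - 1)) * (u t (j - 1)%nat) ^ 2)
}.

Definition noise_path (T : R) (w : R -> R) : Prop :=
  continuous_on (segment T) w /\ w 0 = 0.

(* Main.v *)
Require Import Defs.
From Stdlib Require Import Reals Lra Lia Psatz Classical FunctionalExtensionality.
From Coquelicot Require Import Coquelicot.
Open Scope R_scope.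

(** Write q = 2^(c/3), so that 1 < q < 2 and 2^(c j) = q^(3 j).

    The argument compares two solutions X and Y through the weighted sums
    D_n = sum_(j <= n) 2^(-j) (X_j - Y_j)^2, where the noises h and g have been
    subtracted from the components of index 0. The weights 2^(-j) are exactly
    those for which the cross terms of the nonlinearity telescope
    ([distance_derive]):

      D_n' = forcing - sum_(j <= n) 2^(-j) q^(3j) (X_j - Y_j)^2 (X_(j+1) + Y_(j+1))
             - 2^(-n) q^(3n) (X_n^2 - Y_n^2) (X_(n+1) - Y_(n+1)).

    The forcing is proportional to h - g, the sum is nonnegative because the
    components of positive index are, and the last term has to be shown to
    vanish in time average as n tends to infinity.

    That is where c < 3 enters. The energy of a solution stays bounded
    (Gronwall, [energy_bound]) and hence so does the time integral of the flux
    q^(3n) X_n^2 X_(n+1) ([flux_bound]). The integrated equation of X_(n+1) bounds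
    the integral of q^(3n) X_n^2 by that of q^(3n+3) X_(n+1) X_(n+2); by Young's
    inequality the latter is controlled by the flux and by the integral of
    X_(n+2)^2. With b_n = q^(2n) int X_n^2 this reads b_n <= K + b_(n+2) / 32,
    while b_n = O(q^(2n)) a priori; since q^4 < 32, iterating gives b_n <= 2 K
    ([L2_decay]). The boundary term is then O((q / 2)^n)
    ([distance_inequality]).

    Letting n tend to infinity, the squared weighted distance at time t is at
    most a multiple of the initial one plus a bound that vanishes with the
    distance of the noises ([stability_estimate]). If the noises coincide, it is
    at most the initial one minus the time integral of any single dissipation
    term ([strict_contraction]). If X_j and
    Y_j differ at time 0, the term of index j is positive at some time:
    otherwise X_(j+1) and Y_(j+1) would vanish on an initial interval, and
    their equations would force X_j = Y_j = 0 there
    ([exists_dissipation_pos]). *)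

(** * Continuity, integration and monotonicity of real functions *)

Lemma cont_plus (f g : R -> R) (x : R) :
  continuous f x -> continuous g x -> continuous (fun t => f t + g t) x.
Proof. exact (continuous_plus f g x). Qed.

Lemma cont_opp (f : R -> R) (x : R) :
  continuous f x -> continuous (fun t => - f t) x.
Proof. exact (continuous_opp f x). Qed.

Lemma cont_minus (f g : R -> R) (x : R) :
  continuous f x -> continuous g x -> continuous (fun t => f t - g t) x.
Proof. exact (continuous_minus f g x). Qed.

Lemma cont_mult (f g : R -> R) (x : R) :
  continuous f x -> continuous g x -> continuous (fun t => f t * g t) x.
Proof. exact (continuous_mult f g x). Qed.

Lemma cont_pow (f : R -> R) (n : nat) (x : R) :
  continuous f x -> continuous (fun t => f t ^ n) x.
Proof.
  intros Hf. induction n as [|n IH]; simpl.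
  - apply continuous_const.
  - apply cont_mult; assumption.
Qed.

Lemma cont_sum_n (f : nat -> R -> R) (n : nat) (x : R) :
  (forall j, continuous (f j) x) ->
  continuous (fun t => sum_n (fun j => f j t) n) x.
Proof.
  intros Hf. induction n as [|n IH].
  - apply continuous_ext with (f 0%nat); [|apply Hf].
    intros t. now rewrite sum_O.
  - apply continuous_ext with (fun t => sum_n (fun j => f j t) n + f (S n) t).
    + intros t. now rewrite sum_Sn.
    + now apply cont_plus.
Qed.

(** Reduces the continuity of an arithmetic expression to that of its atoms. *)
Ltac cont :=
  lazymatch goal with
  | |- continuous (fun t => @?f t + @?g t) ?x => apply (cont_plus f g x); cont
  | |- continuous (fun t => @?f t - @?g t) ?x => apply (cont_minus f g x); cont
  | |- continuous (fun t => @?f t * @?g t) ?x => apply (cont_mult f g x); cont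
  | |- continuous (fun t => - @?f t) ?x => apply (cont_opp f x); cont
  | |- continuous (fun t => @?f t ^ ?n) ?x => apply (cont_pow f n x); cont
  | |- continuous _ _ => first [solve [auto] | apply continuous_const]
  end.

Lemma ex_RInt_cont (f : R -> R) (a b : R) :
  (forall x, continuous f x) -> ex_RInt f a b.
Proof. intros Hf. apply (ex_RInt_continuous (V := R_CompleteNormedModule)). auto. Qed.

Lemma RInt_lincomb (a b : R) (f g : R -> R) (x y : R) :
  (forall t, continuous f t) -> (forall t, continuous g t) ->
  RInt (fun t => a * f t + b * g t) x y = a * RInt f x y + b * RInt g x y.
Proof.
  intros Hf Hg.
  pose proof (RInt_scal (V := R_CompleteNormedModule) f x y a
                (ex_RInt_cont f x y Hf)) as Ef.
  pose proof (RInt_scal (V := R_CompleteNormedModule) g x y b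
                (ex_RInt_cont g x y Hg)) as Eg.
  pose proof (RInt_plus (V := R_CompleteNormedModule)
                (fun t => a * f t) (fun t => b * g t) x y) as E.
  unfold scal, plus in *; simpl in *; unfold mult in *; simpl in *.
  rewrite E, Ef, Eg; [reflexivity| |]; apply ex_RInt_cont; intros; cont.
Qed.

Lemma RInt_cst (a tau : R) : RInt (fun _ => a) 0 tau = a * tau.
Proof.
  rewrite RInt_const. change ((tau - 0) * a = a * tau). ring.
Qed.

Lemma is_derive_RInt_cont (g : R -> R) (t : R) :
  (forall x, continuous g x) -> is_derive (fun s => RInt g 0 s) t (g t).
Proof.
  intros Hg. apply (is_derive_RInt (V := R_NormedModule)) with 0.
  - exists (mkposreal 1 Rlt_0_1). intros y _.
    apply (RInt_correct (V := R_CompleteNormedModule)).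
    now apply ex_RInt_cont.
  - apply Hg.
Qed.

(** Nothing is assumed about the derivative at the end points 0 and T. *)
Lemma increment_le_RInt (T tau : R) (F dF G : R -> R) :
  0 <= tau <= T ->
  (forall t, continuous F t) -> (forall t, continuous G t) ->
  (forall t, 0 < t < T -> is_derive F t (dF t)) ->
  (forall t, 0 < t < T -> dF t <= G t) ->
  F tau - F 0 <= RInt G 0 tau.
Proof.
  intros Ht HF HG Hd Hle.
  (* Truncating the slope at 0 makes it nonpositive also at the end points. *)
  destruct (MVT_gen (fun t => F t - RInt G 0 t) 0 tau
              (fun t => Rmin (dF t - G t) 0)) as [c [_ Hc]].
  - rewrite Rmin_left, Rmax_right by lra. intros x Hx.
    rewrite Rmin_left by (specialize (Hle x); lra).
    apply (is_derive_minus (K := R_AbsRing) (V := R_NormedModule) F).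
    + apply Hd; lra.
    + now apply is_derive_RInt_cont.
  - intros x _. apply continuity_pt_filterlim.
    apply (cont_minus F); [apply HF|].
    apply (ex_derive_continuous (K := R_AbsRing) (V := R_NormedModule)).
    exists (G x). now apply is_derive_RInt_cont.
  - rewrite RInt_point in Hc. change (zero (G := R_CompleteNormedModule)) with 0 in Hc.
    pose proof (Rmin_r (dF c - G c) 0). nra.
Qed.

Lemma RInt_pos_of_point (g : R -> R) (tau s : R) :
  (forall t, continuous g t) ->
  (forall t, 0 <= t <= tau -> 0 <= g t) ->
  0 < s < tau -> 0 < g s -> 0 < RInt g 0 tau.
Proof.
  intros Hg Hpos Hs Hgs.
  assert (Hloc : locally s (fun t => 0 < g t)).
  { apply (Hg s (fun y => 0 < y)).
    exists (mkposreal _ Hgs). intros y Hy.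
    unfold ball in Hy; simpl in Hy; unfold AbsRing_ball, abs, minus, plus, opp in Hy; simpl in Hy.
    apply Rabs_def2 in Hy. lra. }
  destruct Hloc as [eps Heps].
  set (e := Rmin (eps / 2) (tau - s)).
  assert (He : 0 < e) by (apply Rmin_glb_lt; destruct eps; simpl; lra).
  assert (He1 : e <= eps / 2) by apply Rmin_l.
  assert (He2 : e <= tau - s) by apply Rmin_r.
  assert (Hmid : 0 < RInt g s (s + e)).
  { apply RInt_gt_0; [lra| |intros; apply Hg].
    intros x Hx. apply Heps.
    unfold ball; simpl; unfold AbsRing_ball, abs, minus, plus, opp; simpl.
    apply Rabs_def1; destruct eps; simpl in *; lra. }
  rewrite <- (RInt_Chasles (V := R_CompleteNormedModule) g 0 s tau)
    by (now apply ex_RInt_cont).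
  rewrite <- (RInt_Chasles (V := R_CompleteNormedModule) g s (s + e) tau)
    by (now apply ex_RInt_cont).
  assert (0 <= RInt g 0 s).
  { apply RInt_ge_0; [lra|now apply ex_RInt_cont|intros; apply Hpos; lra]. }
  assert (0 <= RInt g (s + e) tau).
  { apply RInt_ge_0; [lra|now apply ex_RInt_cont|intros; apply Hpos; lra]. }
  change (0 < RInt g 0 s + (RInt g s (s + e) + RInt g (s + e) tau)). lra.
Qed.

(** * Energy estimates *)

(** In this part and the next ones, a solution is a family of functions of time
    X j : R -> R. The noise h enters additively in component 0 only. *)

(** The components with the noise removed from component 0; unlike X 0, the
    resulting function is differentiable. *)
Definition denoised (X : nat -> R -> R) (h : R -> R) (j : nat) (t : R) : R :=
  match j with O => X 0%nat t - h t | S _ => X j t end.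

(** Right-hand side of the system, with q ^ (3 * j) in place of 2^(c j). *)
Definition drift (q : R) (x : nat -> R) (j : nat) : R :=
  - q ^ (3 * j) * x j * x (S j)
  + match j with O => 0 | S i => q ^ (3 * i) * x i ^ 2 end.

(** Solutions extended to all times as continuous functions, so that neither
    the continuity nor the sign of a component has a side condition on time;
    the equations are required on the open interval only. *)
Record regular_solution (q T : R) (h : R -> R) (X : nat -> R -> R) : Prop := {
  reg_noise_continuous : forall t, continuous h t;
  reg_noise_0 : h 0 = 0;
  reg_continuous : forall j t, continuous (X j) t;
  reg_nonneg : forall j t, 0 <= X (S j) t;
  reg_derive : forall j t, 0 < t < T ->
    is_derive (denoised X h j) t (drift q (fun i => X i t) j)
}.

(** Energy of the components of index at most n, without the noise. *)
Definition energy (X : nat -> R -> R) (h : R -> R) (n : nat) (t : R) : R :=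
  sum_n (fun j => denoised X h j t ^ 2) n.

(** Bound for the energy on [0,T], when the energy at time 0 is at most E0 and
    the noise is at most W in absolute value. *)
Definition energy_cap (E0 W T : R) : R := (E0 + W ^ 2) * exp (2 * W * T).

(** Corresponding bound for the squares of all components; component 0 is the
    sum of a term of square at most [energy_cap] and of the noise. *)
Definition component_cap (E0 W T : R) : R := 2 * energy_cap E0 W T + 2 * W ^ 2.

Lemma denoised_continuous (q T : R) (h : R -> R) (X : nat -> R -> R) :
  regular_solution q T h X -> forall j t, continuous (denoised X h j) t.
Proof.
  intros [Hh _ HX _ _] [|j] t; unfold denoised; cont.
Qed.

Lemma sum_n_nonneg (a : nat -> R) (n : nat) :
  (forall j, 0 <= a j) -> 0 <= sum_n a n.
Proof.
  intros Ha. induction n as [|n IH].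
  - rewrite sum_O. apply Ha.
  - rewrite sum_Sn. change (0 <= sum_n a n + a (S n)). specialize (Ha (S n)). lra.
Qed.

Lemma term_le_sum_n (a : nat -> R) (j n : nat) :
  (forall j, 0 <= a j) -> (j <= n)%nat -> a j <= sum_n a n.
Proof.
  intros Ha Hj. induction Hj as [|n Hj IH].
  - destruct j as [|j].
    + rewrite sum_O. lra.
    + rewrite sum_Sn. change (a (S j) <= sum_n a j + a (S j)).
      pose proof (sum_n_nonneg a j Ha). lra.
  - rewrite sum_Sn. change (a j <= sum_n a n + a (S n)). specialize (Ha (S n)). lra.
Qed.

Lemma is_derive_sq (f : R -> R) (t l : R) :
  is_derive f t l -> is_derive (fun s => f s ^ 2) t (2 * f t * l).
Proof.
  intros Hf. pose proof (is_derive_pow f 2 t l Hf) as H. simpl in H.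
  replace (2 * f t * l) with ((1 + 1) * l * (f t * 1)) by ring. exact H.
Qed.

(** Only the work of the noise and the flux out of component n survive. *)
Lemma energy_derive (q T : R) (h : R -> R) (X : nat -> R -> R) :
  regular_solution q T h X ->
  forall n t, 0 < t < T ->
    is_derive (energy X h n) t
      (2 * h t * X 0%nat t * X 1%nat t
       - 2 * (q ^ (3 * n) * X n t ^ 2 * X (S n) t)).
Proof.
  intros HX n t Ht. unfold energy. induction n as [|n IH].
  - apply (is_derive_ext (fun s => denoised X h 0 s ^ 2)).
    { intros s. now rewrite sum_O. }
    replace (_ - _) with (2 * denoised X h 0 t * drift q (fun i => X i t) 0)
      by (unfold denoised, drift; simpl; ring).
    apply is_derive_sq. now apply (reg_derive _ _ _ _ HX).
  - apply (is_derive_ext (fun s => sum_n (fun j => denoised X h j s ^ 2) n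
                                   + denoised X h (S n) s ^ 2)).
    { intros s. now rewrite sum_Sn. }
    replace (_ - _) with
      (2 * h t * X 0%nat t * X 1%nat t
        - 2 * (q ^ (3 * n) * X n t ^ 2 * X (S n) t)
       + 2 * denoised X h (S n) t * drift q (fun i => X i t) (S n))
      by (unfold denoised, drift; ring).
    apply (is_derive_plus (K := R_AbsRing) (V := R_NormedModule)).
    + exact IH.
    + apply is_derive_sq. now apply (reg_derive _ _ _ _ HX).
Qed.

Lemma energy_nonneg (X : nat -> R -> R) (h : R -> R) (n : nat) (t : R) :
  0 <= energy X h n t.
Proof. apply sum_n_nonneg. intros j. apply pow2_ge_0. Qed.

Lemma energy_continuous (q T : R) (h : R -> R) (X : nat -> R -> R) :
  regular_solution q T h X -> forall n t, continuous (energy X h n) t.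
Proof.
  intros HX n t. apply (cont_sum_n (fun j t => denoised X h j t ^ 2)).
  intros j. apply cont_pow. now apply (denoised_continuous q T).
Qed.

(** The energy up to index 1 at least is needed, since X 1 appears in the work
    of the noise. *)
Lemma noise_work_le (X : nat -> R -> R) (h : R -> R) (W : R) (n : nat) (t : R) :
  Rabs (h t) <= W ->
  2 * h t * X 0%nat t * X 1%nat t <= 2 * W * (energy X h (S n) t + W ^ 2).
Proof.
  intros Hh.
  assert (H01 : energy X h 1 t <= energy X h (S n) t).
  { induction n as [|n IH]; [lra|]. apply Rle_trans with (1 := IH).
    unfold energy. rewrite (sum_Sn _ (S n)).
    unfold plus; simpl. pose proof (pow2_ge_0 (X (S (S n)) t)). simpl in H. lra. }
  set (e := energy X h (S n) t) in *. clearbody e.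
  unfold energy in H01. rewrite sum_Sn, sum_O in H01.
  unfold denoised, plus in H01. cbn -[pow] in H01.
  set (a := X 0%nat t - h t) in *.
  assert (Hx : X 0%nat t = a + h t) by (unfold a; ring). rewrite Hx.
  set (y := X 1%nat t) in *.
  assert (0 <= W) by (pose proof (Rabs_pos (h t)); lra).
  assert (Hh2 : h t ^ 2 <= W ^ 2).
  { rewrite <- (pow2_abs (h t)). apply pow_incr. split; [apply Rabs_pos|exact Hh]. }
  apply Rabs_le_between in Hh.
  assert (Hp : 2 * (a + h t) * y <= 2 * a ^ 2 + 2 * h t ^ 2 + y ^ 2).
  { assert (0 <= (a + h t - y) ^ 2 + (a - h t) ^ 2)
      by (apply Rplus_le_le_0_compat; apply pow2_ge_0). lra. }
  assert (Hm : - (2 * (a + h t) * y) <= 2 * a ^ 2 + 2 * h t ^ 2 + y ^ 2).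
  { assert (0 <= (a + h t + y) ^ 2 + (a - h t) ^ 2)
      by (apply Rplus_le_le_0_compat; apply pow2_ge_0). lra. }
  assert (HQ : 0 <= 2 * a ^ 2 + 2 * h t ^ 2 + y ^ 2) by
   (pose proof (pow2_ge_0 a); pose proof (pow2_ge_0 (h t)); pose proof (pow2_ge_0 y); lra).
  apply Rle_trans with (W * (2 * a ^ 2 + 2 * h t ^ 2 + y ^ 2)).
  - replace (2 * h t * (a + h t) * y) with (h t * (2 * (a + h t) * y)) by ring.
    set (m := 2 * (a + h t) * y) in *.
    apply Rle_trans with (W * Rabs m).
    + apply Rle_trans with (1 := Rle_abs _). rewrite Rabs_mult.
      apply Rmult_le_compat_r; [apply Rabs_pos|].
      now apply Rabs_le_between.
    + apply Rmult_le_compat_l; [assumption|]. apply Rabs_le_between. lra.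
  - apply Rle_trans with (W * (2 * (e + W ^ 2))); [|lra].
    apply Rmult_le_compat_l; [assumption|].
    pose proof (pow2_ge_0 y). lra.
Qed.

(** Gronwall's lemma applied to the energy plus W^2. *)
Lemma energy_bound (q T E0 W : R) (h : R -> R) (X : nat -> R -> R) :
  0 < q -> regular_solution q T h X -> (forall t, Rabs (h t) <= W) ->
  (forall n, energy X h n 0 <= E0) ->
  forall n t, 0 <= t <= T -> energy X h n t <= energy_cap E0 W T.
Proof.
  intros Hq HX HW HS.
  assert (W0 : 0 <= W) by (pose proof (Rabs_pos (h 0)); specialize (HW 0); lra).
  assert (HSn : forall n t, 0 <= t <= T ->
            energy X h (S n) t <= energy_cap E0 W T).
  { intros n t Ht.
    pose proof (increment_le_RInt T t
      (fun s => (energy X h (S n) s + W ^ 2) * exp (- (2 * W) * s))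
      (fun s => (2 * h s * X 0%nat s * X 1%nat s
         - 2 * (q ^ (3 * S n) * X (S n) s ^ 2
                * X (S (S n)) s)
         - 2 * W * (energy X h (S n) s + W ^ 2)) * exp (- (2 * W) * s))
      (fun _ => 0) Ht) as H.
    rewrite RInt_cst in H.
    assert (Hexp : forall s l, is_derive (energy X h (S n)) s l ->
      is_derive (fun s => (energy X h (S n) s + W ^ 2) * exp (- (2 * W) * s)) s
        ((l - 2 * W * (energy X h (S n) s + W ^ 2)) * exp (- (2 * W) * s))).
    { intros s l Hl. set (en := energy X h (S n)) in *. clearbody en.
      auto_derive.
      - exists l; exact Hl.
      - change (fun x => en x) with en. rewrite (is_derive_unique _ _ _ Hl). ring. }
    lapply H; clear H.
    2:{ intros s. apply cont_mult.
        - apply cont_plus; [now apply (energy_continuous q T)|apply continuous_const].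
        - apply (ex_derive_continuous (K := R_AbsRing) (V := R_NormedModule)).
          auto_derive. auto. }
    intros H; lapply H; clear H; [|intros; apply continuous_const].
    intros H; lapply H; clear H.
    2:{ intros s Hs. apply Hexp. now apply (energy_derive q T). }
    intros H; lapply H; clear H.
    2:{ intros s Hs. pose proof (noise_work_le X h W n s (HW s)).
        assert (0 <= q ^ (3 * S n) * X (S n) s ^ 2
                * X (S (S n)) s).
        { apply Rmult_le_pos; [apply Rmult_le_pos|].
          - apply pow_le; lra.
          - apply pow2_ge_0.
          - apply (reg_nonneg _ _ _ _ HX). }
        pose proof (exp_pos (- (2 * W) * s)).
        nra. }
    intros H. rewrite Rmult_0_r, Rmult_0_l, exp_0 in H.
    assert (He : exp (2 * W * t) * exp (- (2 * W) * t) = 1).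
    { rewrite <- exp_plus. replace (_ + _) with 0 by ring. apply exp_0. }
    assert (Hle : exp (2 * W * t) <= exp (2 * W * T)).
    { destruct (Req_dec (2 * W * t) (2 * W * T)) as [->|]; [lra|].
      left. apply exp_increasing. assert (2 * W * t <= 2 * W * T) by nra. lra. }
    unfold energy_cap. specialize (HS (S n)).
    pose proof (energy_nonneg X h (S n) 0).
    pose proof (exp_pos (2 * W * t)). pose proof (pow2_ge_0 W).
    assert (energy X h (S n) t + W ^ 2 <= (E0 + W ^ 2) * exp (2 * W * t)).
    { replace (energy X h (S n) t + W ^ 2) with
       (((energy X h (S n) t + W ^ 2) * exp (- (2 * W) * t)) * exp (2 * W * t))
       by (rewrite Rmult_assoc, (Rmult_comm (exp (- _ * _))), He; ring).
      apply Rmult_le_compat_r; lra. }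
    nra. }
  intros [|n] t Ht; [|now apply HSn].
  apply Rle_trans with (2 := HSn 0%nat t Ht).
  unfold energy. rewrite sum_Sn. unfold plus; simpl.
  pose proof (pow2_ge_0 (X 1%nat t)) as Hp. simpl in Hp. lra.
Qed.

Lemma denoised_sq_bound (q T E0 W : R) (h : R -> R) (X : nat -> R -> R) :
  0 < q -> regular_solution q T h X -> (forall t, Rabs (h t) <= W) ->
  (forall n, energy X h n 0 <= E0) ->
  forall j t, 0 <= t <= T -> denoised X h j t ^ 2 <= energy_cap E0 W T.
Proof.
  intros Hq HX HW HS j t Ht.
  apply Rle_trans with (2 := energy_bound q T E0 W h X Hq HX HW HS j t Ht).
  apply (term_le_sum_n (fun j => denoised X h j t ^ 2)); [|lia].
  intros i. apply pow2_ge_0.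
Qed.

Lemma component_sq_bound (q T E0 W : R) (h : R -> R) (X : nat -> R -> R) :
  0 < q -> regular_solution q T h X -> (forall t, Rabs (h t) <= W) ->
  (forall n, energy X h n 0 <= E0) ->
  forall j t, 0 <= t <= T -> X j t ^ 2 <= component_cap E0 W T.
Proof.
  intros Hq HX HW HS j t Ht. unfold component_cap.
  pose proof (denoised_sq_bound q T E0 W h X Hq HX HW HS j t Ht) as H.
  pose proof (pow2_ge_0 (denoised X h j t)) as H0.
  destruct j as [|j]; unfold denoised in *.
  - assert (Hh2 : h t ^ 2 <= W ^ 2).
    { rewrite <- (pow2_abs (h t)). apply pow_incr. split; [apply Rabs_pos|apply HW]. }
    pose proof (pow2_ge_0 (X 0%nat t - 2 * h t)). nra.
  - pose proof (pow2_ge_0 W). lra.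
Qed.

Lemma flux_bound (q T E0 W : R) (h : R -> R) (X : nat -> R -> R) :
  0 < q -> regular_solution q T h X -> (forall t, Rabs (h t) <= W) ->
  (forall n, energy X h n 0 <= E0) ->
  forall n tau, 0 <= tau <= T ->
    RInt (fun s => q ^ (3 * n) * X n s ^ 2 * X (S n) s) 0 tau
    <= E0 + T * (2 * W * (energy_cap E0 W T + W ^ 2)).
Proof.
  intros Hq HX HW HS n tau Ht.
  assert (W0 : 0 <= W) by (pose proof (Rabs_pos (h 0)); specialize (HW 0); lra).
  pose proof (reg_continuous _ _ _ _ HX) as HC.
  set (A := 2 * W * (energy_cap E0 W T + W ^ 2)).
  pose proof (increment_le_RInt T tau (energy X h n)
    (fun t => 2 * h t * X 0%nat t * X 1%nat t
       - 2 * (q ^ (3 * n) * X n t ^ 2 * X (S n) t))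
    (fun t => A * 1 + (-2) * (q ^ (3 * n) * X n t ^ 2 * X (S n) t)) Ht
    (energy_continuous q T h X HX n)) as H.
  lapply H; clear H; [|intros; cont].
  intros H; lapply H; clear H; [|intros; now apply (energy_derive q T)].
  intros H; lapply H; clear H.
  2:{ intros t Htt. pose proof (noise_work_le X h W 0 t (HW t)).
      pose proof (energy_bound q T E0 W h X Hq HX HW HS 1 t).
      assert (2 * W * (energy X h 1 t + W ^ 2) <= A).
      { unfold A. apply Rmult_le_compat_l; lra. }
      lra. }
  rewrite (RInt_lincomb A (-2) (fun _ => 1)
     (fun t => q ^ (3 * n) * X n t ^ 2 * X (S n) t)) by (intros; cont).
  rewrite RInt_cst.
  intros H.
  assert (HA : 0 <= A).
  { unfold A. pose proof (energy_nonneg X h 0 tau).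
    pose proof (energy_bound q T E0 W h X Hq HX HW HS 0 tau Ht).
    pose proof (pow2_ge_0 W).
    apply Rmult_le_pos; lra. }
  pose proof (energy_nonneg X h n tau). specialize (HS n).
  pose proof (energy_nonneg X h n 0).
  assert (A * tau <= T * A) by nra.
  match goal with H : _ <= A * _ + -2 * ?I |- _ => set (J := I) in * end.
  change (J <= E0 + T * A).
  nra.
Qed.

(** * Decay of the time integrals of the squares *)

(** Young's inequality twice: x is absorbed by r x^2, which produces the flux
    x^2 y, and the remaining multiple of y by q^4 r^3 y^2 / 32. *)
Lemma young_product (q r x y : R) :
  0 < q -> 0 < r -> 0 <= y ->
  q ^ 3 * r ^ 3 * x * y
  <= r * (q ^ 3 * r ^ 3 * x ^ 2 * y) + q ^ 4 * r ^ 3 / 32 * y ^ 2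
     + q ^ 2 * r / 2.
Proof.
  intros Hq Hr Hy.
  assert (H1 : 0 <= q ^ 3 * r ^ 2 * y * (r * x - 1 / 2) ^ 2).
  { apply Rmult_le_pos; [|apply pow2_ge_0]. apply Rmult_le_pos; [|lra].
    apply Rmult_le_pos; apply pow_le; lra. }
  assert (H2 : 0 <= q ^ 2 * r * (q * r * y / 4 - 1) ^ 2 / 2).
  { apply Rmult_le_pos; [|lra]. apply Rmult_le_pos; [|apply pow2_ge_0].
    apply Rmult_le_pos; [apply pow2_ge_0|lra]. }
  nra.
Qed.

(** The bound is obtained by integrating the equation of component n + 1, with
    r = q^n, and dividing by r. *)
Lemma L2_decay_step (q T E0 W : R) (h : R -> R) (X : nat -> R -> R) :
  1 < q < 2 -> regular_solution q T h X -> (forall t, Rabs (h t) <= W) ->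
  (forall n, energy X h n 0 <= E0) ->
  forall n tau, 0 <= tau <= T ->
    q ^ (2 * n) * RInt (fun s => X n s ^ 2) 0 tau
    <= (1 + component_cap E0 W T
        + (E0 + T * (2 * W * (energy_cap E0 W T + W ^ 2))) + 2 * T)
       + q ^ (2 * (n + 2)) * RInt (fun s => X (n + 2)%nat s ^ 2) 0 tau / 32.
Proof.
  intros Hq HX HW HS n tau Ht.
  assert (Hq0 : 0 < q) by lra.
  pose proof (reg_continuous _ _ _ _ HX) as HC.
  pose proof (reg_nonneg _ _ _ _ HX) as HP.
  set (r := q ^ n).
  assert (Hr : 1 <= r) by (apply pow_R1_Rle; lra).
  replace (n + 2)%nat with (S (S n)) by lia.
  set (m := S n). set (p := S m).
  pose proof (increment_le_RInt T tau (fun t => - X m t)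
    (fun t => - drift q (fun i => X i t) m)
    (fun t => 1 * (r * (q ^ (3 * m) * X m t ^ 2 * X p t)
                   + q ^ 4 * r ^ 3 / 32 * X p t ^ 2)
              + 1 * (q ^ 2 * r / 2 * 1 + - r ^ 3 * X n t ^ 2)) Ht) as H.
  lapply H; clear H; [|intros; cont].
  intros H; lapply H; clear H; [|intros; cont].
  intros H; lapply H; clear H.
  2:{ intros t Htt. apply (is_derive_opp (K := R_AbsRing) (V := R_NormedModule) (X m)).
      exact (reg_derive _ _ _ _ HX m t Htt). }
  assert (Ek : q ^ (3 * m) = q ^ 3 * r ^ 3).
  { unfold r, m. rewrite <- pow_mult, <- pow_add. f_equal. lia. }
  assert (Er : q ^ (3 * n) = r ^ 3).
  { unfold r. rewrite <- pow_mult. f_equal. lia. }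
  intros H; lapply H; clear H.
  2:{ intros t Htt. unfold drift, m. fold m. fold p. rewrite Ek, Er.
      pose proof (young_product q r (X m t) (X p t)).
      specialize (HP m t). fold p in HP. lra. }
  rewrite (RInt_lincomb 1 1 (fun t => r * (q ^ (3 * m) * X m t ^ 2 * X p t)
                   + q ^ 4 * r ^ 3 / 32 * X p t ^ 2)
             (fun t => q ^ 2 * r / 2 * 1 + - r ^ 3 * X n t ^ 2)) by (intros; cont).
  rewrite (RInt_lincomb r (q ^ 4 * r ^ 3 / 32)
             (fun t => q ^ (3 * m) * X m t ^ 2 * X p t)
             (fun t => X p t ^ 2)) by (intros; cont).
  rewrite (RInt_lincomb (q ^ 2 * r / 2) (- r ^ 3)
             (fun _ => 1) (fun t => X n t ^ 2)) by (intros; cont).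
  rewrite RInt_cst.
  pose proof (flux_bound q T E0 W h X Hq0 HX HW HS m tau Ht) as HF.
  fold p in HF.
  set (C1 := E0 + T * (2 * W * (energy_cap E0 W T + W ^ 2))) in *.
  set (F := RInt (fun s => q ^ (3 * m) * X m s ^ 2 * X p s) 0 tau) in *.
  set (Bn := RInt (fun s => X n s ^ 2) 0 tau).
  set (Bp := RInt (fun s => X p s ^ 2) 0 tau).
  pose proof (component_sq_bound q T E0 W h X Hq0 HX HW HS m tau Ht) as HQ.
  set (Q := component_cap E0 W T) in *.
  assert (HXm : X m tau <= 1 + Q).
  { pose proof (pow2_ge_0 (X m tau - 1 / 2)). nra. }
  pose proof (HP n 0) as H0. fold m in H0.
  assert (E2n : q ^ (2 * n) = r ^ 2).
  { unfold r. rewrite <- pow_mult. f_equal. lia. }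
  assert (E2p : q ^ (2 * p) = q ^ 4 * r ^ 2).
  { unfold r, p, m. rewrite <- pow_mult, <- pow_add. f_equal. lia. }
  rewrite E2n, E2p. intros H.
  assert (HF' : r * F <= r * C1) by (apply Rmult_le_compat_l; lra).
  assert (HQr : 1 + Q <= r * (1 + Q)).
  { pose proof (pow2_ge_0 (X m tau)). nra. }
  assert (Htau : q ^ 2 * r / 2 * (1 * tau) <= r * (2 * T)).
  { replace (q ^ 2 * r / 2 * (1 * tau)) with (r * (q ^ 2 / 2 * tau)) by field.
    apply Rmult_le_compat_l; [lra|].
    assert (q ^ 2 <= 4) by nra. nra. }
  apply Rmult_le_reg_l with r; [lra|].
  assert (r * (r ^ 2 * Bn) = r ^ 3 * Bn) by ring.
  assert (r * (q ^ 4 * r ^ 2 * Bp / 32) = q ^ 4 * r ^ 3 / 32 * Bp) by field.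
  lra.
Qed.

(** Equivalently, the time integral of X_n^2 is of order 2^(- 2 c n / 3); the
    constant K depends neither on n nor on the time. *)
Lemma L2_decay (q T E0 W : R) (h : R -> R) (X : nat -> R -> R) :
  1 < q < 2 -> 0 <= T -> regular_solution q T h X -> (forall t, Rabs (h t) <= W) ->
  (forall n, energy X h n 0 <= E0) ->
  exists K, 0 <= K /\ forall n tau, 0 <= tau <= T ->
    q ^ (2 * n) * RInt (fun s => X n s ^ 2) 0 tau <= K.
Proof.
  intros Hq HT HX HW HS.
  assert (Hq0 : 0 < q) by lra.
  pose proof (L2_decay_step q T E0 W h X Hq HX HW HS) as Hstep.
  set (K := 1 + component_cap E0 W T
        + (E0 + T * (2 * W * (energy_cap E0 W T + W ^ 2))) + 2 * T) in *.
  pose proof (reg_continuous _ _ _ _ HX) as HC.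
  set (Q := component_cap E0 W T) in *.
  assert (HQ : forall n t, 0 <= t <= T -> X n t ^ 2 <= Q)
    by (intros; now apply (component_sq_bound q T E0 W h X)).
  assert (HB : forall n tau, 0 <= tau <= T ->
            0 <= RInt (fun s => X n s ^ 2) 0 tau <= Q * T).
  { intros n tau Ht.
    assert (Hex : ex_RInt (fun s => X n s ^ 2) 0 tau)
      by (apply ex_RInt_cont; intros; cont).
    split.
    - apply RInt_ge_0; [lra|exact Hex|intros; apply pow2_ge_0].
    - apply Rle_trans with (Q * tau).
      + rewrite <- RInt_cst. apply RInt_le; [lra|exact Hex| |].
        * apply ex_RInt_cont. intros; cont.
        * intros x Hx. apply HQ. lra.
      + apply Rmult_le_compat_l; [|lra].
        apply Rle_trans with (2 := HQ 0%nat 0 (conj (Rle_refl 0) HT)).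
        apply pow2_ge_0. }
  (* Each use of the recursion costs a factor q^4 / 32 < 1/2. *)
  assert (Hit : forall k n tau, 0 <= tau <= T ->
     q ^ (2 * n) * RInt (fun s => X n s ^ 2) 0 tau
     <= 2 * K + Q * T * q ^ (2 * n) * (1 / 2) ^ k).
  { assert (HK : 0 <= K).
    { specialize (Hstep 0%nat 0 (conj (Rle_refl 0) HT)).
      rewrite !RInt_point in Hstep.
      change (zero (G := R_CompleteNormedModule)) with 0 in Hstep. lra. }
    intros k. induction k as [|k IH]; intros n tau Ht.
    - assert (0 <= q ^ (2 * n)) by (apply pow_le; lra).
      specialize (HB n tau Ht). simpl ((1 / 2) ^ 0). nra.
    - apply Rle_trans with (1 := Hstep n tau Ht).
      specialize (IH (n + 2)%nat tau Ht).
      assert (E : q ^ (2 * (n + 2)) = q ^ 4 * q ^ (2 * n)).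
      { rewrite <- pow_add. f_equal. lia. }
      rewrite E in IH at 2. simpl ((1 / 2) ^ S k).
      assert (Hh : 0 <= (1 / 2) ^ k) by (apply pow_le; lra).
      assert (Hp : 0 <= q ^ (2 * n)) by (apply pow_le; lra).
      assert (HQT : 0 <= Q * T) by (specialize (HB 0%nat 0 (conj (Rle_refl 0) HT)); lra).
      assert (Hq4 : q ^ 4 <= 16).
      { replace 16 with (2 ^ 4) by ring. apply pow_incr. lra. }
      assert (HM : 0 <= Q * T * q ^ (2 * n) * (1 / 2) ^ k)
        by (apply Rmult_le_pos; [now apply Rmult_le_pos|exact Hh]).
      set (M := Q * T * q ^ (2 * n) * (1 / 2) ^ k) in *.
      replace (Q * T * (q ^ 4 * q ^ (2 * n)) * (1 / 2) ^ k) with (q ^ 4 * M) in IH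
        by (unfold M; ring).
      replace (Q * T * q ^ (2 * n) * (1 / 2 * (1 / 2) ^ k)) with (M / 2)
        by (unfold M; field).
      assert (q ^ 4 * M <= 16 * M) by (apply Rmult_le_compat_r; assumption).
      lra. }
  exists (2 * K). split.
  { specialize (Hstep 0%nat 0 (conj (Rle_refl 0) HT)).
    rewrite !RInt_point in Hstep.
    change (zero (G := R_CompleteNormedModule)) with 0 in Hstep. lra. }
  intros n tau Ht.
  set (b := q ^ (2 * n) * RInt (fun s => X n s ^ 2) 0 tau) in *.
  assert (Hlim : Rbar_le b (2 * K + Q * T * q ^ (2 * n) * 0)).
  { apply (is_lim_seq_le (fun _ => b)
             (fun k => 2 * K + Q * T * q ^ (2 * n) * (1 / 2) ^ k)).
    - intros k. now apply Hit.
    - apply is_lim_seq_const.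
    - apply is_lim_seq_plus'; [apply is_lim_seq_const|].
      apply (is_lim_seq_scal_l _ _ 0). apply is_lim_seq_geom.
      rewrite Rabs_pos_eq; lra. }
  simpl in Hlim. lra.
Qed.

(** * The weighted distance of two solutions *)

(** Difference of the denoised components of X, with noise h, and Y, with
    noise g. *)
Definition gap (X : nat -> R -> R) (h : R -> R) (Y : nat -> R -> R) (g : R -> R)
    (j : nat) (t : R) : R :=
  denoised X h j t - denoised Y g j t.

(** Partial sums of the squared norm with weights 2^(-j) of the gap. *)
Definition distance (X : nat -> R -> R) (h : R -> R) (Y : nat -> R -> R) (g : R -> R)
    (n : nat) (t : R) : R :=
  sum_n (fun j => (1 / 2) ^ j * gap X h Y g j t ^ 2) n.

(** Rate of decrease of the distance due to the components j and j + 1. *)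
Definition dissipation (q : R) (X : nat -> R -> R) (h : R -> R)
    (Y : nat -> R -> R) (g : R -> R) (j : nat) (t : R) : R :=
  (1 / 2) ^ j * q ^ (3 * j) * gap X h Y g j t ^ 2 * (X (S j) t + Y (S j) t).

(** Effect on the distance of the difference of the noises. *)
Definition forcing (X : nat -> R -> R) (h : R -> R) (Y : nat -> R -> R) (g : R -> R)
    (t : R) : R :=
  (h t - g t) * ((X 0%nat t + Y 0%nat t) * (X 1%nat t - Y 1%nat t)
                 - gap X h Y g 0 t * (X 1%nat t + Y 1%nat t)).

(** Interaction of the components n and n + 1, left over by truncating the
    distance at index n. *)
Definition boundary (q : R) (X Y : nat -> R -> R) (n : nat) (t : R) : R :=
  (1 / 2) ^ n * q ^ (3 * n) * ((X n t ^ 2 - Y n t ^ 2) * (X (S n) t - Y (S n) t)).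

(** The interactions between components of index at most n cancel. *)
Lemma distance_derive (q T : R) (h g : R -> R) (X Y : nat -> R -> R) :
  regular_solution q T h X -> regular_solution q T g Y ->
  forall n t, 0 < t < T ->
    is_derive (distance X h Y g n) t
      (forcing X h Y g t - sum_n (fun j => dissipation q X h Y g j t) n
       - boundary q X Y n t).
Proof.
  intros HX HY n t Ht.
  assert (Hterm : forall j, is_derive (fun s => (1 / 2) ^ j * gap X h Y g j s ^ 2) t
     ((1 / 2) ^ j * (2 * gap X h Y g j t
        * (drift q (fun i => X i t) j - drift q (fun i => Y i t) j)))).
  { intros j. apply (is_derive_scal (fun s => gap X h Y g j s ^ 2)).
    apply is_derive_sq.
    apply (is_derive_minus (K := R_AbsRing) (V := R_NormedModule)
             (denoised X h j) (denoised Y g j)).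
    - now apply (reg_derive _ _ _ _ HX).
    - now apply (reg_derive _ _ _ _ HY). }
  unfold distance. induction n as [|n IH].
  - apply (is_derive_ext (fun s => (1 / 2) ^ 0 * gap X h Y g 0 s ^ 2)).
    { intros s. now rewrite sum_O. }
    rewrite sum_O.
    replace (_ - _ - _) with ((1 / 2) ^ 0 * (2 * gap X h Y g 0 t
        * (drift q (fun i => X i t) 0 - drift q (fun i => Y i t) 0)))
      by (unfold forcing, dissipation, boundary, gap, denoised, drift; simpl; field).
    apply Hterm.
  - apply (is_derive_ext (fun s => sum_n (fun j => (1 / 2) ^ j * gap X h Y g j s ^ 2) n
              + (1 / 2) ^ (S n) * gap X h Y g (S n) s ^ 2)).
    { intros s. now rewrite sum_Sn. }
    rewrite sum_Sn.
    change (plus ?a ?b) with (a + b).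
    set (D := sum_n (fun j => dissipation q X h Y g j t) n) in *.
    replace (_ - _ - _) with
      (forcing X h Y g t - D - boundary q X Y n t
       + (1 / 2) ^ (S n) * (2 * gap X h Y g (S n) t
        * (drift q (fun i => X i t) (S n) - drift q (fun i => Y i t) (S n)))).
    + apply (is_derive_plus (K := R_AbsRing) (V := R_NormedModule)); [exact IH|apply Hterm].
    + unfold dissipation, boundary, gap, denoised, drift.
      change ((1 / 2) ^ S n) with (1 / 2 * (1 / 2) ^ n). field.
Qed.

Lemma dissipation_nonneg (q T : R) (h g : R -> R) (X Y : nat -> R -> R) :
  0 < q -> regular_solution q T h X -> regular_solution q T g Y ->
  forall j t, 0 <= dissipation q X h Y g j t.
Proof.
  intros Hq HX HY j t. unfold dissipation.
  apply Rmult_le_pos; [apply Rmult_le_pos; [apply Rmult_le_pos|]|].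
  - apply pow_le; lra.
  - apply pow_le; lra.
  - apply pow2_ge_0.
  - pose proof (reg_nonneg _ _ _ _ HX j t). pose proof (reg_nonneg _ _ _ _ HY j t). lra.
Qed.

Lemma gap_continuous (q T : R) (h g : R -> R) (X Y : nat -> R -> R) :
  regular_solution q T h X -> regular_solution q T g Y ->
  forall j t, continuous (gap X h Y g j) t.
Proof.
  intros HX HY j t. apply (cont_minus (denoised X h j) (denoised Y g j)).
  - now apply (denoised_continuous q T).
  - now apply (denoised_continuous q T).
Qed.

Lemma dissipation_continuous (q T : R) (h g : R -> R) (X Y : nat -> R -> R) :
  regular_solution q T h X -> regular_solution q T g Y ->
  forall j t, continuous (dissipation q X h Y g j) t.
Proof.
  intros HX HY j t.
  pose proof (reg_continuous _ _ _ _ HX) as HXc.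
  pose proof (reg_continuous _ _ _ _ HY) as HYc.
  pose proof (gap_continuous q T h g X Y HX HY) as Hg.
  unfold dissipation. cont.
Qed.

Lemma boundary_ge (x y x' y' L : R) :
  0 <= x' <= L -> 0 <= y' <= L ->
  - ((x ^ 2 - y ^ 2) * (x' - y')) <= L * (x ^ 2 + y ^ 2).
Proof.
  intros Hx Hy. pose proof (pow2_ge_0 x). pose proof (pow2_ge_0 y). nra.
Qed.

(** The remainder C (q / 2)^n tends to 0, and C does not depend on n; the other
    dissipation terms are nonnegative and are dropped. *)
Lemma distance_inequality (q T E0 W F : R) (h g : R -> R) (X Y : nat -> R -> R) :
  1 < q < 2 -> 0 <= T ->
  regular_solution q T h X -> regular_solution q T g Y ->
  (forall t, Rabs (h t) <= W) -> (forall t, Rabs (g t) <= W) ->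
  (forall n, energy X h n 0 <= E0) -> (forall n, energy Y g n 0 <= E0) ->
  (forall t, 0 <= t <= T -> forcing X h Y g t <= F) ->
  exists C, forall n j tau, (j <= n)%nat -> 0 <= tau <= T ->
    distance X h Y g n tau + RInt (dissipation q X h Y g j) 0 tau
    <= distance X h Y g n 0 + F * tau + C * (q / 2) ^ n.
Proof.
  intros Hq HT HX HY HWX HWY HSX HSY HF.
  assert (Hq0 : 0 < q) by lra.
  destruct (L2_decay q T E0 W h X Hq HT HX HWX HSX) as [KX [HKX HdX]].
  destruct (L2_decay q T E0 W g Y Hq HT HY HWY HSY) as [KY [HKY HdY]].
  set (Q := component_cap E0 W T).
  assert (HLX : forall n t, 0 <= t <= T -> X n t <= 1 + Q).
  { intros n t Ht.
    pose proof (component_sq_bound q T E0 W h X Hq0 HX HWX HSX n t Ht) as HQ.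
    fold Q in HQ. pose proof (pow2_ge_0 (X n t - 1 / 2)). nra. }
  assert (HLY : forall n t, 0 <= t <= T -> Y n t <= 1 + Q).
  { intros n t Ht.
    pose proof (component_sq_bound q T E0 W g Y Hq0 HY HWY HSY n t Ht) as HQ.
    fold Q in HQ. pose proof (pow2_ge_0 (Y n t - 1 / 2)). nra. }
  assert (HL : 0 <= 1 + Q).
  { pose proof (component_sq_bound q T E0 W h X Hq0 HX HWX HSX 0 0
                  (conj (Rle_refl 0) HT)) as HQ.
    pose proof (pow2_ge_0 (X 0%nat 0)). fold Q in HQ. lra. }
  pose proof (reg_continuous _ _ _ _ HX) as HXc.
  pose proof (reg_continuous _ _ _ _ HY) as HYc.
  pose proof (gap_continuous q T h g X Y HX HY) as Hgap.
  pose proof (dissipation_continuous q T h g X Y HX HY) as Hdc.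
  exists ((1 + Q) * (KX + KY)). intros n j tau Hj Ht.
  set (k := (1 / 2) ^ n * q ^ (3 * n)).
  assert (Hk : 0 <= k) by (apply Rmult_le_pos; apply pow_le; lra).
  pose proof (increment_le_RInt T tau (distance X h Y g n)
    (fun t => forcing X h Y g t - sum_n (fun j => dissipation q X h Y g j t) n
       - boundary q X Y n t)
    (fun t => 1 * (F * 1 + - (1) * dissipation q X h Y g j t)
              + k * (1 + Q) * (1 * X n t ^ 2 + 1 * Y n t ^ 2)) Ht) as H.
  lapply H; clear H.
  2:{ intros t. apply (cont_sum_n (fun j t => (1 / 2) ^ j * gap X h Y g j t ^ 2)).
      intros i. cont. }
  intros H; lapply H; clear H; [|intros; cont].
  intros H; lapply H; clear H; [|intros; now apply distance_derive with T].
  intros H; lapply H; clear H.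
  2:{ intros t Htt.
      pose proof (HF t).
      pose proof (term_le_sum_n (fun i => dissipation q X h Y g i t) j n
                    (fun i => dissipation_nonneg q T h g X Y Hq0 HX HY i t) Hj) as Hd.
      cbv beta in Hd.
      assert (Hb : - boundary q X Y n t <= k * (1 + Q) * (X n t ^ 2 + Y n t ^ 2)).
      { unfold boundary. fold k.
        pose proof (boundary_ge (X n t) (Y n t) (X (S n) t)
          (Y (S n) t) (1 + Q)
          (conj (reg_nonneg _ _ _ _ HX n t) (HLX (S n) t ltac:(lra)))
          (conj (reg_nonneg _ _ _ _ HY n t) (HLY (S n) t ltac:(lra)))).
        nra. }
      lra. }
  rewrite (RInt_lincomb 1 (k * (1 + Q))
    (fun t => F * 1 + - (1) * dissipation q X h Y g j t)
    (fun t => 1 * X n t ^ 2 + 1 * Y n t ^ 2)) by (intros; cont).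
  rewrite (RInt_lincomb F (- (1)) (fun _ => 1) (dissipation q X h Y g j)) by (intros; cont).
  rewrite (RInt_lincomb 1 1 (fun t => X n t ^ 2) (fun t => Y n t ^ 2)) by (intros; cont).
  rewrite RInt_cst. intros H.
  specialize (HdX n tau Ht). specialize (HdY n tau Ht).
  set (BX := RInt (fun t => X n t ^ 2) 0 tau) in *.
  set (BY := RInt (fun t => Y n t ^ 2) 0 tau) in *.
  assert (Ek : k = (q / 2) ^ n * q ^ (2 * n)).
  { unfold k. replace (3 * n)%nat with (n + 2 * n)%nat by lia.
    rewrite pow_add. replace (q / 2) with (1 / 2 * q) by field.
    rewrite Rpow_mult_distr. ring. }
  assert (Hqn : 0 <= (q / 2) ^ n) by (apply pow_le; lra).
  assert (Hfin : k * (1 + Q) * (1 * BX + 1 * BY) <= (1 + Q) * (KX + KY) * (q / 2) ^ n).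
  { rewrite Ek.
    replace (_ * _ * (1 + Q) * _)
      with ((1 + Q) * (q ^ (2 * n) * BX + q ^ (2 * n) * BY) * (q / 2) ^ n) by ring.
    apply Rmult_le_compat_r; [assumption|]. apply Rmult_le_compat_l; lra. }
  lra.
Qed.

Lemma forcing_le (x0 y0 a b x1 y1 e eta Q : R) :
  Rabs e <= eta -> x0 ^ 2 <= Q -> y0 ^ 2 <= Q -> a ^ 2 <= Q -> b ^ 2 <= Q ->
  x1 ^ 2 <= Q -> y1 ^ 2 <= Q ->
  e * ((x0 + y0) * (x1 - y1) - (a - b) * (x1 + y1)) <= 8 * Q * eta.
Proof.
  intros He H1 H2 H3 H4 H5 H6.
  set (m := _ - _).
  assert (Hm : Rabs m <= 8 * Q).
  { assert (Hprod : forall u v, u ^ 2 <= 4 * Q -> v ^ 2 <= 4 * Q -> Rabs (u * v) <= 4 * Q).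
    { intros u v Hu Hv. apply Rabs_le_between.
      pose proof (pow2_ge_0 (u - v)). pose proof (pow2_ge_0 (u + v)). split; nra. }
    assert (Hadd : forall u v, u ^ 2 <= Q -> v ^ 2 <= Q -> (u + v) ^ 2 <= 4 * Q).
    { intros u v Hu Hv. pose proof (pow2_ge_0 (u - v)). nra. }
    assert (Hsub : forall u v, u ^ 2 <= Q -> v ^ 2 <= Q -> (u - v) ^ 2 <= 4 * Q).
    { intros u v Hu Hv. pose proof (pow2_ge_0 (u + v)). nra. }
    unfold m. apply Rle_trans with (1 := Rabs_triang _ _). rewrite Rabs_Ropp.
    pose proof (Hprod (x0 + y0) (x1 - y1) (Hadd _ _ H1 H2) (Hsub _ _ H5 H6)).
    pose proof (Hprod (a - b) (x1 + y1) (Hsub _ _ H3 H4) (Hadd _ _ H5 H6)).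
    lra. }
  apply Rle_trans with (1 := Rle_abs _). rewrite Rabs_mult, Rmult_comm.
  apply Rmult_le_compat; try apply Rabs_pos; assumption.
Qed.

Lemma R_ball (x y e : R) : ball x e y <-> Rabs (y - x) < e.
Proof. reflexivity. Qed.

(** With equal noises, two solutions that differ in component j at time 0
    dissipate through index j at some positive time. *)
Lemma exists_dissipation_pos (q T tau : R) (h g : R -> R) (X Y : nat -> R -> R)
    (j : nat) :
  0 < q -> 0 < tau <= T ->
  regular_solution q T h X -> regular_solution q T g Y ->
  gap X h Y g j 0 <> 0 ->
  (forall t, h t = g t) ->
  exists s, 0 < s < tau /\ 0 < dissipation q X h Y g j s.
Proof.
  intros Hq Ht HX HY Hj Hhg.
  apply NNPP. intros Hno.
  assert (Hzero : forall s, 0 < s < tau -> dissipation q X h Y g j s = 0).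
  { intros s Hs. pose proof (dissipation_nonneg q T h g X Y Hq HX HY j s).
    destruct (Rle_lt_or_eq_dec _ _ H) as [Hp|Hp]; [|now symmetry].
    destruct Hno. now exists s. }
  assert (Hloc : locally 0 (fun s => gap X h Y g j s <> 0)).
  { apply (gap_continuous q T h g X Y HX HY j 0 (fun y => y <> 0)).
    exists (mkposreal _ (Rabs_pos_lt _ Hj)). intros y Hy Hy0.
    apply (proj1 (R_ball _ _ _)) in Hy. subst y.
    change (Rabs (0 - gap X h Y g j 0) < Rabs (gap X h Y g j 0)) in Hy.
    rewrite Rminus_0_l, Rabs_Ropp in Hy. lra. }
  destruct Hloc as [eps Heps].
  set (e := Rmin eps tau).
  assert (He : 0 < e) by (apply Rmin_glb_lt; [apply cond_pos|lra]).
  assert (He1 : e <= eps) by apply Rmin_l.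
  assert (He2 : e <= tau) by apply Rmin_r.
  assert (Hgap : forall s, 0 < s < e -> gap X h Y g j s <> 0).
  { intros s Hs. apply Heps. apply R_ball. rewrite Rminus_0_r, Rabs_pos_eq; lra. }
  assert (Hnext : forall s, 0 < s < e -> X (S j) s = 0 /\ Y (S j) s = 0).
  { intros s Hs. specialize (Hzero s ltac:(lra)). unfold dissipation in Hzero.
    pose proof (reg_nonneg _ _ _ _ HX j s). pose proof (reg_nonneg _ _ _ _ HY j s).
    apply Rmult_integral in Hzero. destruct Hzero as [Hz|Hz]; [exfalso|lra].
    revert Hz.
    apply Rmult_integral_contrapositive_currified;
      [apply Rmult_integral_contrapositive_currified|].
    - apply pow_nonzero; lra.
    - apply pow_nonzero; lra.
    - apply pow_nonzero. now apply Hgap. }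
  (* Component j + 1 is zero on (0,e), hence so is its derivative, which is then
     reduced to the inflow q^(3j) Z_j^2. *)
  assert (Hvanish : forall h' Z, regular_solution q T h' Z ->
            (forall s, 0 < s < e -> Z (S j) s = 0) -> Z j (e / 2) = 0).
  { intros h' Z HZ HZ0.
    pose proof (reg_derive _ _ _ _ HZ (S j) (e / 2) ltac:(lra)) as Hd.
    assert (Hc : is_derive (denoised Z h' (S j)) (e / 2) 0).
    { apply (is_derive_ext_loc (fun _ => 0)).
      - exists (mkposreal (e / 2) ltac:(lra)). intros y Hy.
        apply (proj1 (R_ball _ _ _)) in Hy. simpl in Hy. apply Rabs_def2 in Hy.
        symmetry. apply HZ0. lra.
      - apply (is_derive_const (K := R_AbsRing) (V := R_NormedModule)). }
    apply is_derive_unique in Hd. apply is_derive_unique in Hc.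
    rewrite Hc in Hd. unfold drift in Hd. rewrite (HZ0 (e / 2)) in Hd by lra.
    assert (Hsq : q ^ (3 * j) * Z j (e / 2) ^ 2 = 0).
    { cbv beta in Hd. rewrite Hd. ring. }
    apply Rmult_integral in Hsq. destruct Hsq as [Hsq|Hsq].
    - exfalso. revert Hsq. apply pow_nonzero; lra.
    - destruct (Req_dec (Z j (e / 2)) 0) as [|Hne]; [assumption|].
      exfalso. revert Hsq. now apply pow_nonzero. }
  apply (Hgap (e / 2)); [lra|].
  pose proof (Hvanish h X HX (fun s Hs => proj1 (Hnext s Hs))) as E1.
  pose proof (Hvanish g Y HY (fun s Hs => proj2 (Hnext s Hs))) as E2.
  unfold gap, denoised. destruct j; rewrite E1, E2; [rewrite Hhg|]; ring.
Qed.

(** * From solutions on a segment to solutions at all times *)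

(** Nearest point of [0,T]. Composing with it extends a function given on the
    segment continuously by constants. *)
Definition clamp (T t : R) : R := Rmax 0 (Rmin t T).

Lemma clamp_segment (T t : R) : 0 <= T -> segment T (clamp T t).
Proof.
  intros HT. unfold segment, clamp, Rmax, Rmin.
  repeat destruct Rle_dec; lra.
Qed.

Lemma clamp_id (T t : R) : segment T t -> clamp T t = t.
Proof.
  unfold segment, clamp, Rmax, Rmin. intros H. repeat destruct Rle_dec; lra.
Qed.

Lemma clamp_contract (T s t : R) : Rabs (clamp T t - clamp T s) <= Rabs (t - s).
Proof.
  unfold clamp, Rmax, Rmin, Rabs.
  repeat destruct Rle_dec; repeat destruct Rcase_abs; lra.
Qed.

Lemma continuous_clamp (T : R) (f : R -> R) :
  0 <= T -> continuous_on (segment T) f ->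
  forall t, continuous (fun s => f (clamp T s)) t.
Proof.
  intros HT Hf t P HP.
  specialize (Hf (clamp T t) (clamp_segment T t HT) P HP).
  destruct Hf as [eps Heps]. exists eps. intros y Hy.
  apply Heps; [|now apply clamp_segment].
  apply (proj1 (R_ball _ _ _)) in Hy. apply R_ball.
  apply Rle_lt_trans with (2 := Hy). apply clamp_contract.
Qed.

Lemma clamp_locally_id (T t : R) : 0 < t < T -> locally t (fun s => clamp T s = s /\ 0 < s < T).
Proof.
  intros Ht.
  assert (He : 0 < Rmin t (T - t)) by (apply Rmin_glb_lt; lra).
  exists (mkposreal _ He). intros y Hy. apply (proj1 (R_ball _ _ _)) in Hy. simpl in Hy.
  pose proof (Rmin_l t (T - t)). pose proof (Rmin_r t (T - t)).
  apply Rabs_def2 in Hy. split; [apply clamp_id; unfold segment|]; lra.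
Qed.

(** At an interior point, the derivative relative to the segment is the usual
    one. *)
Lemma is_derive_within_interior (T : R) (f : R -> R) (t l : R) :
  0 < t < T -> is_derive_within (segment T) f t l -> is_derive f t l.
Proof.
  intros Ht Hd. apply is_derive_Reals. intros eps Heps.
  destruct (Hd (ball l eps)) as [d1 Hd1].
  { exists (mkposreal eps Heps). auto. }
  destruct (clamp_locally_id T t Ht) as [d2 Hd2].
  assert (Hd12 : 0 < Rmin d1 d2) by (apply Rmin_glb_lt; apply cond_pos).
  exists (mkposreal _ Hd12). intros e He0 He. simpl in He.
  pose proof (Rmin_l d1 d2). pose proof (Rmin_r d1 d2).
  assert (Ee : t + e - t = e) by ring.
  specialize (Hd1 (t + e)). specialize (Hd2 (t + e)).
  rewrite !R_ball, !Ee in *.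
  apply Hd1; [lra|lra|].
  destruct Hd2 as [_ Hseg]; [lra|]. unfold segment. lra.
Qed.

Lemma Rpower_2_pow (c : R) (j : nat) :
  Rpower 2 (c * INR j) = Rpower 2 (c / 3) ^ (3 * j).
Proof.
  rewrite <- Rpower_pow by apply exp_pos.
  rewrite Rpower_mult. f_equal. rewrite mult_INR. simpl. field.
Qed.

Lemma solution_regular (c sigma T : R) (u_init : nat -> R) (w : R -> R)
    (u : R -> nat -> R) :
  0 <= T -> noise_path T w -> is_solution c sigma T u_init w u ->
  regular_solution (Rpower 2 (c / 3)) T (fun t => sigma * w (clamp T t))
    (fun j t => u (clamp T t) j).
Proof.
  intros HT [Hwc Hw0] Hu.
  assert (HC : forall j t, continuous (fun s => u (clamp T s) j) t).
  { intros j t. apply (continuous_clamp T (fun s => u s j) HT).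
    apply (sol_continuous _ _ _ _ _ _ Hu). }
  assert (H0T : segment T 0) by (unfold segment; lra).
  split.
  - intros t. apply cont_mult; [apply continuous_const|].
    now apply continuous_clamp.
  - rewrite clamp_id by assumption. rewrite Hw0. ring.
  - exact HC.
  - intros j t. apply (sol_Hplus _ _ _ _ _ _ Hu); [now apply clamp_segment|lia].
  - intros [|i] t Ht.
    + set (p := fun s => u (clamp T s) 1%nat * u (clamp T s) 0%nat).
      assert (Hp : forall s, continuous p s) by (intros s; unfold p; cont).
      apply (is_derive_ext_loc (fun s => u 0 0%nat - RInt p 0 s)).
      { generalize (clamp_locally_id T t Ht). apply filter_imp.
        intros s [Hs Hs']. unfold denoised. rewrite Hs.
        rewrite (sol_zero _ _ _ _ _ _ Hu s) by (unfold segment; lra).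
        rewrite (RInt_ext p (fun s => u s 1%nat * u s 0%nat)).
        - match goal with |- ?a = ?b => change (@eq R a b) end. ring.
        - rewrite Rmin_left, Rmax_right by lra. intros x Hx. unfold p.
          rewrite clamp_id by (unfold segment; lra). reflexivity. }
      replace (drift _ _ 0%nat) with (0 - p t) by (unfold drift, p; simpl; ring).
      apply (is_derive_minus (K := R_AbsRing) (V := R_NormedModule) (fun _ => u 0 0%nat)).
      * apply (is_derive_const (K := R_AbsRing) (V := R_NormedModule)).
      * now apply is_derive_RInt_cont.
    + apply (is_derive_ext_loc (fun s => u s (S i))).
      { generalize (clamp_locally_id T t Ht). apply filter_imp.
        intros s [Hs _]. unfold denoised. now rewrite Hs. }
      apply (is_derive_within_interior T); [assumption|].
      assert (Hseg : segment T t) by (unfold segment; lra).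
      pose proof (sol_succ _ _ _ _ _ _ Hu (S i) ltac:(lia) t Hseg) as Hd.
      unfold drift. rewrite clamp_id by assumption.
      rewrite <- !Rpower_2_pow.
      replace (S i + 1)%nat with (S (S i)) in Hd by lia.
      replace (S i - 1)%nat with i in Hd by lia.
      replace (INR (S i) - 1) with (INR i) in Hd by (rewrite S_INR; ring).
      exact Hd.
Qed.

(** * Square summable sequences and suprema *)
Lemma sum_n_le_Series (a : nat -> R) (n : nat) :
  (forall j, 0 <= a j) -> ex_series a -> sum_n a n <= Series a.
Proof.
  intros Ha Hex. apply (is_lim_seq_incr_compare (sum_n a) (Series a)).
  - exact (Series_correct a Hex).
  - intros m. rewrite sum_Sn. change (sum_n a m <= sum_n a m + a (S m)).
    specialize (Ha (S m)). lra.
Qed.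

Lemma Series_le_of_partial_sums (a : nat -> R) (A C r : R) (N : nat) :
  0 <= r < 1 -> ex_series a ->
  (forall n, (N <= n)%nat -> sum_n a n <= A + C * r ^ n) -> Series a <= A.
Proof.
  intros Hr Hex Hle.
  assert (Hlim : Rbar_le (Series a) (A + C * 0)).
  { apply (is_lim_seq_le_loc (sum_n a) (fun n => A + C * r ^ n)).
    - exists N. exact Hle.
    - exact (Series_correct a Hex).
    - apply is_lim_seq_plus'; [apply is_lim_seq_const|].
      apply (is_lim_seq_scal_l _ _ 0). apply is_lim_seq_geom.
      rewrite Rabs_pos_eq; lra. }
  simpl in Hlim. lra.
Qed.

Lemma sum_n_le (a b : nat -> R) (n : nat) :
  (forall j, a j <= b j) -> sum_n a n <= sum_n b n.
Proof. intros H. now apply sum_n_m_le. Qed.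

Lemma sq_minus_le (x y : R) : (x - y) ^ 2 <= 2 * x ^ 2 + 2 * y ^ 2.
Proof. pose proof (pow2_ge_0 (x + y)). lra. Qed.

Lemma sq_dist_summable (x y : nat -> R) :
  in_l2 x -> in_l2 y -> ex_series (fun j => (x j - y j) ^ 2).
Proof.
  intros Hx Hy.
  apply (ex_series_le (K := R_AbsRing) (V := R_CompleteNormedModule) _
           (fun j => 2 * x j ^ 2 + 2 * y j ^ 2)).
  - intros j. change (Rabs ((x j - y j) ^ 2) <= 2 * x j ^ 2 + 2 * y j ^ 2).
    rewrite Rabs_pos_eq by apply pow2_ge_0. apply sq_minus_le.
  - apply (ex_series_plus (K := R_AbsRing) (V := R_NormedModule)
             (fun j => 2 * x j ^ 2) (fun j => 2 * y j ^ 2));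
      apply (ex_series_scal (K := R_AbsRing) (V := R_NormedModule) 2); assumption.
Qed.

Lemma half_pow_bounds (j : nat) : 0 < (1 / 2) ^ j <= 1.
Proof.
  split; [apply pow_lt; lra|].
  apply Rle_trans with (1 ^ j); [apply pow_incr|rewrite pow1]; lra.
Qed.

Lemma weighted_sq_le (j : nat) (x : R) : 0 <= (1 / 2) ^ j * x ^ 2 <= x ^ 2.
Proof.
  pose proof (half_pow_bounds j). pose proof (pow2_ge_0 x). nra.
Qed.

Lemma weighted_sq_dist_summable (x y : nat -> R) :
  in_l2 x -> in_l2 y -> ex_series (fun j => (1 / 2) ^ j * (x j - y j) ^ 2).
Proof.
  intros Hx Hy.
  apply (ex_series_le (K := R_AbsRing) (V := R_CompleteNormedModule) _
           (fun j => (x j - y j) ^ 2)); [|now apply sq_dist_summable].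
  intros j. change (Rabs ((1 / 2) ^ j * (x j - y j) ^ 2) <= (x j - y j) ^ 2).
  rewrite Rabs_pos_eq; apply weighted_sq_le.
Qed.

Lemma norm_minus_half (x y : nat -> R) :
  norm_alpha (-1/2) (seq_sub x y)
  = sqrt (Series (fun j => (1 / 2) ^ j * (x j - y j) ^ 2)).
Proof.
  unfold norm_alpha, seq_sub. f_equal. apply Series_ext. intros j. f_equal.
  replace (2 * (-1/2) * INR j) with (- INR j) by field.
  rewrite Rpower_Ropp, Rpower_pow by lra.
  replace (1 / 2) with (/ 2) by field. symmetry. apply pow_inv.
Qed.

Lemma bounded_noise (T : R) (w : R -> R) :
  0 <= T -> noise_path T w ->
  exists B, 0 <= B /\ forall t, segment T t -> Rabs (w t) <= B.
Proof.
  intros HT [Hw _].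
  pose proof (continuous_clamp T w HT Hw) as Hc.
  destruct (continuity_ab_maj (fun t => w (clamp T t) ^ 2) 0 T HT) as [m [Hm _]].
  { intros t _. apply continuity_pt_filterlim.
    apply (cont_pow (fun t => w (clamp T t))). apply Hc. }
  exists (Rabs (w (clamp T m))). split; [apply Rabs_pos|].
  intros t Ht. apply Rsqr_le_abs_0. rewrite !Rsqr_pow2.
  rewrite <- (clamp_id T t Ht) at 1. apply Hm. exact Ht.
Qed.

Lemma sup_on_lt (T d : R) (f : R -> R) :
  Rbar_lt (sup_on T f) d -> forall t, segment T t -> f t < d.
Proof.
  intros Hlt t Ht. unfold sup_on in Hlt.
  destruct (Lub_Rbar_correct (fun y => exists t, segment T t /\ y = f t)) as [Hub _].
  change (Rbar_lt (f t) d). apply Rbar_le_lt_trans with (2 := Hlt).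
  apply Hub. now exists t.
Qed.

Lemma sup_on_le (T M : R) (f : R -> R) :
  (forall t, segment T t -> f t <= M) -> Rbar_le (sup_on T f) M.
Proof.
  intros Hle. unfold sup_on.
  destruct (Lub_Rbar_correct (fun y => exists t, segment T t /\ y = f t)) as [_ Hlub].
  apply Hlub. intros y [t [Ht ->]]. now apply Hle.
Qed.

Lemma initial_energy_le (c sigma T : R) (u_init : nat -> R) (w : R -> R)
    (u : R -> nat -> R) (n : nat) :
  0 <= T -> noise_path T w -> is_solution c sigma T u_init w u ->
  energy (fun j t => u (clamp T t) j) (fun t => sigma * w (clamp T t)) n 0
  = sum_n (fun j => u_init j ^ 2) n.
Proof.
  intros HT [_ Hw0] Hu. unfold energy. apply sum_n_ext. intros j.
  rewrite <- (sol_init _ _ _ _ _ _ Hu j).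
  assert (E : clamp T 0 = 0) by (apply clamp_id; unfold segment; lra).
  destruct j; unfold denoised; rewrite E; [rewrite Hw0|]; f_equal; ring.
Qed.

(** * Stability and strict contraction *)
Lemma Rpower_2_third_bounds (c : R) : 1 <= c < 3 -> 1 < Rpower 2 (c / 3) < 2.
Proof.
  intros Hc. split.
  - rewrite <- (Rpower_O 2) at 1 by lra. apply Rpower_lt; lra.
  - rewrite <- (Rpower_1 2) at 2 by lra. apply Rpower_lt; lra.
Qed.

Lemma distance_0_le (c sigma T : R) (u_init v_init : nat -> R) (w w' : R -> R)
    (u v : R -> nat -> R) (n : nat) :
  0 <= T -> noise_path T w -> noise_path T w' ->
  is_solution c sigma T u_init w u -> is_solution c sigma T v_init w' v ->
  distance (fun j t => u (clamp T t) j) (fun t => sigma * w (clamp T t))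
           (fun j t => v (clamp T t) j) (fun t => sigma * w' (clamp T t)) n 0
  = sum_n (fun j => (1 / 2) ^ j * (u_init j - v_init j) ^ 2) n.
Proof.
  intros HT [_ Hw0] [_ Hw0'] Hu Hv. unfold distance. apply sum_n_ext. intros j.
  rewrite <- (sol_init _ _ _ _ _ _ Hu j), <- (sol_init _ _ _ _ _ _ Hv j).
  assert (E : clamp T 0 = 0) by (apply clamp_id; unfold segment; lra).
  f_equal. f_equal. unfold gap.
  destruct j; unfold denoised; rewrite !E; [rewrite Hw0, Hw0'|]; ring.
Qed.

Lemma sum_n_plain_le_distance (X : nat -> R -> R) (h : R -> R) (Y : nat -> R -> R)
    (g : R -> R) (n : nat) (t : R) :
  sum_n (fun j => (1 / 2) ^ j * (X j t - Y j t) ^ 2) n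
  <= 2 * distance X h Y g n t + 2 * (h t - g t) ^ 2.
Proof.
  unfold distance. induction n as [|n IH].
  - rewrite !sum_O. unfold gap, denoised.
    assert (Hsq := pow2_ge_0 (X 0%nat t - Y 0%nat t - 2 * (h t - g t))). simpl in *. lra.
  - rewrite !sum_Sn. change (plus ?a ?b) with (a + b).
    unfold gap at 2, denoised.
    pose proof (weighted_sq_le (S n) (X (S n) t - Y (S n) t)). lra.
Qed.

(** Bound for the squared weighted distance at any time in [0,T], when the data of the
    two solutions are within delta, the first noise path is at most B in
    absolute value, and the first initial condition has squared norm E0. The
    arguments of [component_cap] bound the initial energy and the noise of both
    solutions. *)
Definition stability_bound (sigma T B E0 delta : R) : R :=
  2 * delta ^ 2
  + 16 * component_cap (2 * E0 + 2 * delta ^ 2) (sigma * (B + delta)) T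
    * (sigma * delta) * T
  + 2 * (sigma * delta) ^ 2.

Lemma component_cap_nonneg (E0 W T : R) : 0 <= E0 -> 0 <= component_cap E0 W T.
Proof.
  intros H. unfold component_cap, energy_cap.
  pose proof (pow2_ge_0 W). pose proof (exp_pos (2 * W * T)).
  assert (0 <= (E0 + W ^ 2) * exp (2 * W * T)) by (apply Rmult_le_pos; lra).
  lra.
Qed.

Lemma stability_estimate (c T sigma B delta : R) (u_init v_init : nat -> R)
    (w w' : R -> R) (u v : R -> nat -> R) :
  1 <= c < 3 -> 0 <= T -> 0 <= sigma -> 0 < delta ->
  in_Hplus u_init -> in_Hplus v_init -> noise_path T w -> noise_path T w' ->
  (forall t, segment T t -> Rabs (w t) <= B) ->
  (forall t, segment T t -> Rabs (w t - w' t) <= delta) ->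
  Series (fun j => (u_init j - v_init j) ^ 2) <= delta ^ 2 ->
  is_solution c sigma T u_init w u -> is_solution c sigma T v_init w' v ->
  forall t, segment T t ->
    Series (fun j => (1 / 2) ^ j * (u t j - v t j) ^ 2)
    <= stability_bound sigma T B (Series (fun j => u_init j ^ 2)) delta.
Proof.
  intros Hc HT Hs Hd [Hui _] [Hvi _] Hw Hw' HB Hww Hinit Hu Hv t Ht.
  set (q := Rpower 2 (c / 3)).
  assert (Hq : 1 < q < 2) by now apply Rpower_2_third_bounds.
  pose proof (solution_regular c sigma T u_init w u HT Hw Hu) as HX.
  pose proof (solution_regular c sigma T v_init w' v HT Hw' Hv) as HY.
  fold q in HX, HY.
  pose proof (fun n => initial_energy_le c sigma T u_init w u n HT Hw Hu) as HEX.
  pose proof (fun n => initial_energy_le c sigma T v_init w' v n HT Hw' Hv) as HEY.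
  pose proof (fun n => distance_0_le c sigma T u_init v_init w w' u v n
                HT Hw Hw' Hu Hv) as HD0.
  set (X := fun (j : nat) (t : R) => u (clamp T t) j) in *.
  set (Y := fun (j : nat) (t : R) => v (clamp T t) j) in *.
  set (h := fun t : R => sigma * w (clamp T t)) in *.
  set (g := fun t : R => sigma * w' (clamp T t)) in *.
  set (S0 := Series (fun j => u_init j ^ 2)).
  assert (HS0 : forall n, sum_n (fun j => u_init j ^ 2) n <= S0).
  { intros n. apply (sum_n_le_Series (fun j => u_init j ^ 2)); [|exact Hui].
    intros j. apply pow2_ge_0. }
  assert (HS0p : 0 <= S0).
  { apply Rle_trans with (2 := HS0 0%nat). apply sum_n_nonneg.
    intros j. apply pow2_ge_0. }
  assert (Hdiff : forall n, sum_n (fun j => (u_init j - v_init j) ^ 2) n <= delta ^ 2).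
  { intros n. apply Rle_trans with (2 := Hinit).
    apply (sum_n_le_Series (fun j => (u_init j - v_init j) ^ 2)).
    - intros j. apply pow2_ge_0.
    - now apply sq_dist_summable. }
  set (E0 := 2 * S0 + 2 * delta ^ 2).
  set (W := sigma * (B + delta)).
  assert (HWX : forall s, Rabs (h s) <= W).
  { intros s. unfold h, W. rewrite Rabs_mult, (Rabs_pos_eq sigma) by assumption.
    apply Rmult_le_compat_l; [assumption|].
    specialize (HB _ (clamp_segment T s HT)). lra. }
  assert (HWY : forall s, Rabs (g s) <= W).
  { intros s. unfold g, W. rewrite Rabs_mult, (Rabs_pos_eq sigma) by assumption.
    apply Rmult_le_compat_l; [assumption|].
    specialize (HB _ (clamp_segment T s HT)). specialize (Hww _ (clamp_segment T s HT)).
    replace (w' (clamp T s)) with (w (clamp T s) - (w (clamp T s) - w' (clamp T s))) by ring.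
    apply Rle_trans with (1 := Rabs_triang _ _). rewrite Rabs_Ropp. lra. }
  assert (HEX' : forall n, energy X h n 0 <= E0).
  { intros n. rewrite HEX. specialize (HS0 n). pose proof (pow2_ge_0 delta).
    unfold E0. lra. }
  assert (HEY' : forall n, energy Y g n 0 <= E0).
  { intros n. rewrite HEY. specialize (HS0 n). specialize (Hdiff n).
    unfold E0.
    apply Rle_trans with (2 * sum_n (fun j => u_init j ^ 2) n
        + 2 * sum_n (fun j => (u_init j - v_init j) ^ 2) n); [|lra].
    clear. induction n as [|n IH].
    - rewrite !sum_O. pose proof (pow2_ge_0 (2 * u_init 0%nat - v_init 0%nat)). lra.
    - rewrite !sum_Sn. change (plus ?a ?b) with (a + b).
      pose proof (pow2_ge_0 (2 * u_init (S n) - v_init (S n))). lra. }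
  set (Q := component_cap E0 W T).
  assert (HE0 : 0 <= E0) by (pose proof (pow2_ge_0 delta); unfold E0; lra).
  assert (HQ : 0 <= Q) by now apply component_cap_nonneg.
  assert (Hnoise : forall s, Rabs (h s - g s) <= sigma * delta).
  { intros s. unfold h, g. rewrite <- Rmult_minus_distr_l, Rabs_mult, Rabs_pos_eq by assumption.
    apply Rmult_le_compat_l; [assumption|]. apply Hww. now apply clamp_segment. }
  assert (Hcap : energy_cap E0 W T <= Q).
  { unfold Q, component_cap, energy_cap. pose proof (pow2_ge_0 W).
    pose proof (exp_pos (2 * W * T)).
    assert (0 <= (E0 + W ^ 2) * exp (2 * W * T)) by (apply Rmult_le_pos; lra). lra. }
  assert (Hq0 : 0 < q) by lra.
  assert (HF : forall s, 0 <= s <= T -> forcing X h Y g s <= 8 * Q * (sigma * delta)).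
  { intros s Hseg. apply forcing_le.
    - apply Hnoise.
    - now apply (component_sq_bound q T E0 W h X).
    - now apply (component_sq_bound q T E0 W g Y).
    - apply Rle_trans with (2 := Hcap). now apply (denoised_sq_bound q T E0 W h X).
    - apply Rle_trans with (2 := Hcap). now apply (denoised_sq_bound q T E0 W g Y).
    - now apply (component_sq_bound q T E0 W h X).
    - now apply (component_sq_bound q T E0 W g Y). }
  destruct (distance_inequality q T E0 W (8 * Q * (sigma * delta)) h g X Y
              Hq HT HX HY HWX HWY HEX' HEY' HF) as [C HC].
  apply (Series_le_of_partial_sums _ _ (2 * C) (q / 2) 0); [lra| |].
  { apply weighted_sq_dist_summable.
    - apply (sol_Hplus _ _ _ _ _ _ Hu t Ht).
    - apply (sol_Hplus _ _ _ _ _ _ Hv t Ht). }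
  intros n _.
  pose proof (sum_n_plain_le_distance X h Y g n t) as Hsum.
  unfold X at 1, Y at 1 in Hsum. rewrite (clamp_id T t Ht) in Hsum.
  specialize (HC n 0%nat t (Nat.le_0_l n) Ht).
  assert (Hdis : 0 <= RInt (dissipation q X h Y g 0) 0 t).
  { destruct Ht as [Ht0 Ht1]. apply RInt_ge_0; [assumption| |].
    - apply ex_RInt_cont. now apply (dissipation_continuous q T).
    - intros s _. now apply (dissipation_nonneg q T). }
  assert (HD : distance X h Y g n 0 <= delta ^ 2).
  { rewrite HD0. apply Rle_trans with (2 := Hdiff n). apply sum_n_le.
    intros j. apply weighted_sq_le. }
  assert (Heta : (h t - g t) ^ 2 <= (sigma * delta) ^ 2).
  { rewrite <- (pow2_abs (h t - g t)). apply pow_incr. split; [apply Rabs_pos|apply Hnoise]. }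
  assert (Hlin : 8 * Q * (sigma * delta) * t <= 8 * Q * (sigma * delta) * T).
  { apply Rmult_le_compat_l; [|apply Ht].
    apply Rmult_le_pos; [lra|]. apply Rmult_le_pos; lra. }
  unfold stability_bound. fold E0 W Q. lra.
Qed.

Lemma strict_contraction (c T sigma : R) (u_init v_init : nat -> R)
    (w w' : R -> R) (u v : R -> nat -> R) (j : nat) (t : R) :
  1 <= c < 3 -> 0 <= sigma -> 0 < t <= T ->
  in_Hplus u_init -> in_Hplus v_init -> noise_path T w -> noise_path T w' ->
  (forall s, segment T s -> w s = w' s) ->
  u_init j <> v_init j ->
  is_solution c sigma T u_init w u -> is_solution c sigma T v_init w' v ->
  Series (fun j => (1 / 2) ^ j * (u t j - v t j) ^ 2)
  < Series (fun j => (1 / 2) ^ j * (u_init j - v_init j) ^ 2).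
Proof.
  intros Hc Hs Ht [Hui _] [Hvi _] Hw Hw' Hww Hj Hu Hv.
  assert (HT : 0 <= T) by lra.
  assert (Htseg : segment T t) by (unfold segment; lra).
  assert (H0seg : segment T 0) by (unfold segment; lra).
  set (q := Rpower 2 (c / 3)).
  assert (Hq : 1 < q < 2) by now apply Rpower_2_third_bounds.
  assert (Hq0 : 0 < q) by lra.
  destruct (bounded_noise T w HT Hw) as [B [HB0 HB]].
  pose proof (solution_regular c sigma T u_init w u HT Hw Hu) as HX.
  pose proof (solution_regular c sigma T v_init w' v HT Hw' Hv) as HY.
  fold q in HX, HY.
  pose proof (fun n => initial_energy_le c sigma T u_init w u n HT Hw Hu) as HEX.
  pose proof (fun n => initial_energy_le c sigma T v_init w' v n HT Hw' Hv) as HEY.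
  pose proof (fun n => distance_0_le c sigma T u_init v_init w w' u v n
                HT Hw Hw' Hu Hv) as HD0.
  assert (Hgap0 : gap (fun j t => u (clamp T t) j) (fun t => sigma * w (clamp T t))
     (fun j t => v (clamp T t) j) (fun t => sigma * w' (clamp T t)) j 0 <> 0).
  { rewrite <- (sol_init _ _ _ _ _ _ Hu j), <- (sol_init _ _ _ _ _ _ Hv j) in Hj.
    unfold gap, denoised.
    destruct j; rewrite !clamp_id by assumption; [rewrite Hww by assumption|]; lra. }
  set (X := fun (j : nat) (t : R) => u (clamp T t) j) in *.
  set (Y := fun (j : nat) (t : R) => v (clamp T t) j) in *.
  set (h := fun t : R => sigma * w (clamp T t)) in *.
  set (g := fun t : R => sigma * w' (clamp T t)) in *.
  assert (Hhg : forall s, h s = g s).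
  { intros s. unfold h, g. rewrite Hww; [reflexivity|now apply clamp_segment]. }
  set (W := sigma * B).
  assert (HWX : forall s, Rabs (h s) <= W).
  { intros s. unfold h, W. rewrite Rabs_mult, (Rabs_pos_eq sigma) by assumption.
    apply Rmult_le_compat_l; [assumption|]. apply HB. now apply clamp_segment. }
  assert (HWY : forall s, Rabs (g s) <= W) by (intros s; rewrite <- Hhg; apply HWX).
  set (E0 := Series (fun j => u_init j ^ 2) + Series (fun j => v_init j ^ 2)).
  assert (Hpart : forall x n, in_l2 x ->
            0 <= sum_n (fun j => x j ^ 2) n <= Series (fun j => x j ^ 2)).
  { intros x n Hx. split.
    - apply sum_n_nonneg. intros i. apply pow2_ge_0.
    - apply (sum_n_le_Series (fun j => x j ^ 2)); [|exact Hx].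
      intros i. apply pow2_ge_0. }
  assert (HEX' : forall n, energy X h n 0 <= E0).
  { intros n. rewrite HEX. unfold E0.
    pose proof (Hpart u_init n Hui). pose proof (Hpart v_init n Hvi). lra. }
  assert (HEY' : forall n, energy Y g n 0 <= E0).
  { intros n. rewrite HEY. unfold E0.
    pose proof (Hpart u_init n Hui). pose proof (Hpart v_init n Hvi). lra. }
  assert (HF : forall s, 0 <= s <= T -> forcing X h Y g s <= 0).
  { intros s _. unfold forcing. rewrite Hhg. lra. }
  destruct (distance_inequality q T E0 W 0 h g X Y
              Hq HT HX HY HWX HWY HEX' HEY' HF) as [C HC].
  destruct (exists_dissipation_pos q T t h g X Y j Hq0 Ht HX HY Hgap0 Hhg)
    as [s [Hst Hspos]].
  assert (Hdis : 0 < RInt (dissipation q X h Y g j) 0 t).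
  { apply RInt_pos_of_point with s; try assumption.
    - now apply (dissipation_continuous q T).
    - intros r _. now apply (dissipation_nonneg q T). }
  set (I := RInt (dissipation q X h Y g j) 0 t) in *.
  set (D0 := Series (fun j => (1 / 2) ^ j * (u_init j - v_init j) ^ 2)).
  apply Rle_lt_trans with (D0 - I); [|lra].
  apply (Series_le_of_partial_sums _ _ C (q / 2) j); [lra| |].
  { apply weighted_sq_dist_summable.
    - apply (sol_Hplus _ _ _ _ _ _ Hu t Htseg).
    - apply (sol_Hplus _ _ _ _ _ _ Hv t Htseg). }
  intros n Hn. specialize (HC n j t Hn Htseg). fold I in HC.
  assert (HD : distance X h Y g n 0 <= D0).
  { rewrite HD0. apply (sum_n_le_Series (fun j => (1 / 2) ^ j * (u_init j - v_init j) ^ 2)).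
    - intros i. apply weighted_sq_le.
    - now apply weighted_sq_dist_summable. }
  assert (Hdist : distance X h Y g n t
                  = sum_n (fun j => (1 / 2) ^ j * (u t j - v t j) ^ 2) n).
  { unfold distance. apply sum_n_ext. intros i. f_equal. f_equal.
    unfold gap, denoised, X, Y.
    rewrite Hhg, !(clamp_id T t Htseg). destruct i; ring. }
  rewrite <- Hdist. lra.
Qed.

Lemma sqrt_stability_bound_vanishes (sigma T B E0 : R) :
  filterlim (fun d => sqrt (stability_bound sigma T B E0 d) + d)
    (at_right 0) (locally 0).
Proof.
  assert (H0 : stability_bound sigma T B E0 0 = 0) by (unfold stability_bound; ring).
  assert (Hz : sqrt (stability_bound sigma T B E0 0) + 0 = 0).
  { rewrite H0, sqrt_0. ring. }
  rewrite <- Hz at 2.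
  apply (filterlim_filter_le_1 (F := locally 0)).
  { intros P [e He]. exists e. intros y Hy _. now apply He. }
  apply (cont_plus (fun d => sqrt (stability_bound sigma T B E0 d))).
  - apply (continuous_comp (stability_bound sigma T B E0) sqrt).
    + apply (ex_derive_continuous (K := R_AbsRing) (V := R_NormedModule)).
      unfold stability_bound, component_cap, energy_cap. auto_derive. auto.
    + apply continuity_pt_filterlim. apply continuity_pt_sqrt. lra.
  - apply continuous_id.
Qed.

Theorem theorem2p3 (c T sigma : R) (u_init : nat -> R) (w : R -> R)
    (hc : 1 <= c < 3) (hT : 0 <= T) (hsigma : 0 <= sigma)
    (hu_init : in_Hplus u_init) (hw : noise_path T w) :
  (exists f : R -> R,
     (forall d, 0 <= d -> 0 <= f d) /\
     filterlim f (at_right 0) (locally 0) /\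
     forall (delta : R), 0 < delta ->
     forall (v_init : nat -> R) (w' : R -> R),
       in_Hplus v_init -> noise_path T w' ->
       norm_l2 (seq_sub u_init v_init) < delta ->
       Rbar_lt (sup_on T (fun t => Rabs (w t - w' t))) (Finite delta) ->
     forall u v : R -> nat -> R,
       is_solution c sigma T u_init w u ->
       is_solution c sigma T v_init w' v ->
       Rbar_lt (sup_on T (fun t => norm_alpha (-1/2) (seq_sub (u t) (v t))))
               (Finite (f delta)))
  /\
  (forall (v_init : nat -> R) (w' : R -> R),
     in_Hplus v_init -> noise_path T w' ->
     (forall t, segment T t -> w t = w' t) ->
     u_init <> v_init ->
   forall u v : R -> nat -> R,
     is_solution c sigma T u_init w u ->
     is_solution c sigma T v_init w' v ->
   forall t, 0 < t <= T ->
     norm_alpha (-1/2) (seq_sub (u t) (v t))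
     < norm_alpha (-1/2) (seq_sub (u 0) (v 0))).
Proof.
  split.
  - destruct (bounded_noise T w hT hw) as [B [HB0 HB]].
    set (E0 := Series (fun j => u_init j ^ 2)).
    assert (HE0 : 0 <= E0).
    { apply Rle_trans with (sum_n (fun j => u_init j ^ 2) 0).
      - apply sum_n_nonneg. intros j. apply pow2_ge_0.
      - apply (sum_n_le_Series (fun j => u_init j ^ 2)); [|apply hu_init].
        intros j. apply pow2_ge_0. }
    (* The summand [d] turns the bound on the supremum into a strict one. *)
    exists (fun d => sqrt (stability_bound sigma T B E0 d) + d).
    split; [|split].
    + intros d Hd. pose proof (sqrt_pos (stability_bound sigma T B E0 d)). lra.
    + apply sqrt_stability_bound_vanishes.
    + intros delta Hdelta v_init w' Hv_init Hw' Hnorm Hsup u v Hu Hv.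
      assert (Hinit : Series (fun j => (u_init j - v_init j) ^ 2) <= delta ^ 2).
      { unfold norm_l2, seq_sub in Hnorm.
        apply sqrt_le_0.
        - apply Rle_trans with (sum_n (fun j => (u_init j - v_init j) ^ 2) 0).
          + apply sum_n_nonneg. intros j. apply pow2_ge_0.
          + apply (sum_n_le_Series (fun j => (u_init j - v_init j) ^ 2)).
            * intros j. apply pow2_ge_0.
            * apply sq_dist_summable; [apply hu_init|apply Hv_init].
        - apply pow2_ge_0.
        - rewrite sqrt_pow2; lra. }
      apply Rbar_le_lt_trans with (Finite (sqrt (stability_bound sigma T B E0 delta))).
      * apply sup_on_le. intros t Ht. rewrite norm_minus_half. apply sqrt_le_1_alt.
        apply (stability_estimate c T sigma B delta u_init v_init w w' u v);
          try assumption.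
        intros s Hs. apply Rlt_le. now apply (sup_on_lt T delta (fun t => Rabs (w t - w' t))).
      * simpl. lra.
  - intros v_init w' Hv_init Hw' Hww Hne u v Hu Hv t Ht.
    assert (Hj : exists j, u_init j <> v_init j).
    { apply not_all_ex_not. intros Hall. apply Hne.
      now apply functional_extensionality. }
    destruct Hj as [j Hj].
    rewrite !norm_minus_half. apply sqrt_lt_1_alt.
    rewrite (Series_ext (fun j => (1 / 2) ^ j * (u 0 j - v 0 j) ^ 2)
               (fun j => (1 / 2) ^ j * (u_init j - v_init j) ^ 2)).
    2:{ intros i. now rewrite (sol_init _ _ _ _ _ _ Hu), (sol_init _ _ _ _ _ _ Hv). }
    split.
    + apply Rle_trans with (sum_n (fun j => (1 / 2) ^ j * (u t j - v t j) ^ 2) 0).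
      * apply sum_n_nonneg. intros i. apply weighted_sq_le.
      * assert (Htseg : segment T t) by (unfold segment; lra).
        apply (sum_n_le_Series (fun j => (1 / 2) ^ j * (u t j - v t j) ^ 2)).
        -- intros i. apply weighted_sq_le.
        -- apply weighted_sq_dist_summable.
           ++ apply (sol_Hplus _ _ _ _ _ _ Hu t Htseg).
           ++ apply (sol_Hplus _ _ _ _ _ _ Hv t Htseg).
    + now apply (strict_contraction c T sigma u_init v_init w w' u v j t).
Qed.
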